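(* Let $\mathcal{A}$ be the class of finite abelian groups (up to isomorphism), and let $\mathcal{P}$ denote the set of isomorphism classes of finite abelian groups that occur as the group of units in a ring of positive characteristic. Then the density of $\mathcal{P}$ in $\mathcal{A}$ is zero, that is, \[ \lim_{x \to \infty} \frac{\mathcal{P}(x)}{\mathcal{A}(x)} = 0 . \]
   Context: All rings are associative with a multiplicative identity (not necessarily commutative); a group $G$ occurs as the group of units in a ring $R$ if $G \cong R^\times$, where $R^\times$ is the multiplicative group of units of $R$. For a class $\mathcal{C}$ of finite groups up to isomorphism and a positive real $x$, $\mathcal{C}(x)$ denotes the number of isomorphism classes of groups in $\mathcal{C}$ of order at most $x$. The density of a class $\mathcal{C}$ contained in a class $\mathcal{D}$ is $\lim_{x\to\infty} \mathcal{C}(x)/\mathcal{D}(x)$, if the limit exists. *)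

(* Defs.v *)
From HB Require Import structures.
From mathcomp Require Import all_boot all_order all_algebra all_fingroup.
From mathcomp Require Import all_classical all_reals all_analysis.

Set Implicit Arguments.
Unset Strict Implicit.
Unset Printing Implicit Defensive.

Import Order.TTheory GRing.Theory Num.Theory.
Import numFieldNormedType.Exports.

Local Open Scope ring_scope.

Definition group_class := finGroupType -> Prop.

(* [F] lists exactly one representative of every isomorphism class of groups
   that belong to [C] and have order at most [x]. *)
Definition class_representatives (R : realType) (C : group_class) (x : R)
    (k : nat) (F : 'I_k -> finGroupType) : Prop :=
  [/\ forall i, C (F i) /\ #|F i|%:R <= x,
      forall i j, [set: F i] \isog [set: F j] -> i = j
    & forall gT : finGroupType, C gT -> #|gT|%:R <= x ->
        exists i, [set: gT] \isog [set: F i]].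

(* C(x).  The default value 0 of [xget] is never used: see [class_countP]. *)
Definition class_count (R : realType) (C : group_class) (x : R) : nat :=
  xget 0%N [set k : nat | exists F : 'I_k -> finGroupType,
    class_representatives C x F]%classic.

(* Not [pchar], which only sees prime characteristics. *)
Definition has_characteristic (S : pzRingType) (n : nat) : Prop :=
  forall m : nat, m%:R = 0 :> S <-> (n %| m)%N.

Definition positive_characteristic (S : pzRingType) : Prop :=
  exists2 n : nat, (0 < n)%N & has_characteristic S n.

(* [S] may be infinite and has no decidable inverse, so neither [{unit S}] nor
   [GRing.unit] is available. *)
Definition invertible (S : pzRingType) (u : S) : Prop :=
  exists v : S, u * v = 1 /\ v * u = 1.

Definition is_unit_group (gT : finGroupType) (S : pzRingType) : Prop :=
  exists f : gT -> S,
    [/\ injective f,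
        {morph f : a b / (a * b)%g >-> a * b}
      & forall u : S, invertible u <-> exists a : gT, f a = u].

Definition finite_abelian : group_class :=
  fun gT => abelian [set: gT].

Definition abelian_units_positive_characteristic : group_class :=
  fun gT => finite_abelian gT /\
    exists S : pzRingType, positive_characteristic S /\ is_unit_group gT S.

(* Groups of order at most [N] are determined up to isomorphism by their
   multiplication table, which takes finitely many values. *)
Definition mul_table (N : nat) (gT : finGroupType) :
    'I_N.+1 * {ffun 'I_N.+1 * 'I_N.+1 -> 'I_N.+1} :=
  (inord #|gT|, [ffun p : 'I_N.+1 * 'I_N.+1 =>
     inord (index (nth 1 (enum gT) p.1 * nth 1 (enum gT) p.2)%g (enum gT))]).

Lemma mul_table_isog (N : nat) (gT hT : finGroupType) :
  (#|gT| <= N)%N -> (#|hT| <= N)%N -> mul_table N gT = mul_table N hT ->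
  [set: gT] \isog [set: hT].
Proof.
move=> gN hN [/(congr1 val)]; rewrite /= !inordK ?ltnS// => gh /ffunP tE.
have idx (kT : finGroupType) (x : kT) : (index x (enum kT) < #|kT|)%N.
  by rewrite cardE index_mem mem_enum.
pose f (x : gT) : hT := nth 1%g (enum hT) (index x (enum gT)).
have idxf x : index (f x) (enum hT) = index x (enum gT).
  by rewrite /f index_uniq ?enum_uniq// -cardE -gh.
have fK : injective f.
  move=> x y /(congr1 (index^~ (enum hT))); rewrite !idxf => xy.
  rewrite -[x](@nth_index _ 1%g x (enum gT)) ?mem_enum// xy.
  by rewrite nth_index ?mem_enum.
have fM : {in [set: gT] &, {morph f : x y / (x * y)%g}}.
  move=> x y _ _.
  have lN (kT : finGroupType) (z : kT) :
      (#|kT| <= N)%N -> (index z (enum kT) < N.+1)%N.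
    by move=> kN; rewrite ltnS; apply: leq_trans (ltnW (idx _ z)) kN.
  have /(congr1 val)/= :=
    tE (inord (index x (enum gT)), inord (index y (enum gT))).
  rewrite !ffunE /= !inordK ?lN// !nth_index ?mem_enum//.
  by rewrite -/(f x) -/(f y) => xyE; rewrite {1}/f xyE nth_index ?mem_enum.
apply/isogP; exists (Morphism fM); first by apply/injmP => x y _ _; apply: fK.
apply/eqP; rewrite eqEcard finset.subsetT /= card_injm//; last first.
  by apply/injmP => x y _ _; apply: fK.
by rewrite !cardsT gh.
Qed.

Lemma class_representatives_uniq (R : realType) (C : group_class) (x : R)
    (k l : nat) (F : 'I_k -> finGroupType) (G : 'I_l -> finGroupType) :
  class_representatives C x F -> class_representatives C x G -> k = l.
Proof.
suff le m n (F' : 'I_m -> finGroupType) (G' : 'I_n -> finGroupType) :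
    class_representatives C x F' -> class_representatives C x G' -> (m <= n)%N.
  by move=> hF hG; apply/eqP; rewrite eqn_leq !(le _ _ _ _ hF hG, le _ _ _ _ hG hF).
move=> [F1 F2 _] [_ _ G3].
have /choice[h hP] i : exists j, [set: F' i] \isog [set: G' j].
  by have [] := F1 i; apply: G3.
have /leq_card : injective h; last by rewrite !card_ord.
move=> i j hij; apply: F2; apply: isog_trans (hP i) _.
by rewrite hij isog_sym.
Qed.

Lemma class_representatives_exist (R : realType) (C : group_class) (x : R) :
  exists k, exists F : 'I_k -> finGroupType, class_representatives C x F.
Proof.
pose N := Num.truncn x.
pose good k (F : 'I_k -> finGroupType) :=
  (forall i, C (F i) /\ #|F i|%:R <= x) /\
  (forall i j, [set: F i] \isog [set: F j] -> i = j).
have leN (gT : finGroupType) : #|gT|%:R <= x -> (#|gT| <= N)%N.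
  move=> gx; rewrite /N truncn_ge_nat//.
  exact: le_trans (ler0n _ _) gx.
pose P k := `[< exists F : 'I_k -> finGroupType, good k F >].
have P0 : exists k, P k.
  exists 0%N; apply/asboolP; exists (fun=> 'S_0 : finGroupType).
  by split=> -[].
have Pmax k : P k -> (k <= #|{: 'I_N.+1 * {ffun 'I_N.+1 * 'I_N.+1 -> 'I_N.+1}}|)%N.
  move=> /asboolP[F [F1 F2]]; rewrite -[k]card_ord.
  apply: (@leq_card _ _ (fun i => mul_table N (F i))) => i j /mul_table_isog ij.
  by apply: F2; apply: ij; apply: leN; have [] := F1 i; have [] := F1 j.
have [k /asboolP[F [F1 F2]] kmax] := ex_maxnP P0 Pmax.
exists k, F; split=> // gT CG Gx; apply: contrapT => nG.
suff /kmax : P k.+1 by rewrite ltnn.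
apply/asboolP.
exists (fun i => if unlift ord_max i is Some j then F j else gT); split.
  by move=> i; case: unliftP => [j _|_]; [exact: F1|].
move=> i j; case: unliftP => [i'|] ->; case: unliftP => [j'|] -> //.
- by move=> /F2 ->.
- by move=> iG; case: nG; exists i'; rewrite isog_sym.
- by move=> iG; case: nG; exists j'.
Qed.

Lemma class_countP (R : realType) (C : group_class) (x : R) (k : nat) :
  class_count C x = k <->
  exists F : 'I_k -> finGroupType, class_representatives C x F.
Proof.
rewrite /class_count; case: xgetP => [l -> [F hF]|none].
  split=> [<-|[G hG]]; first by exists F.
  exact: class_representatives_uniq hF hG.
have [l hl] := class_representatives_exist C x.
by have := none l hl.
Qed.

(* Main.v *)
Require Import Defs.
From HB Require Import structures.
From mathcomp Require Import all_boot all_order all_algebra all_fingroup.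
From mathcomp Require Import all_solvable.
From mathcomp Require Import all_classical all_reals all_analysis.
From mathcomp Require Import zify ring lra.

(** Only the orders of the groups matter.  If the abelian group G is the unit
    group of a ring of characteristic n > 0, then it is also the unit group of
    the subring of sums of units, a quotient of (Z/n)[G], hence finite and
    commutative.  A finite commutative ring is a product of local rings, and a
    local ring with residue field of order p^k and maximal ideal of order p^a
    has (p^k - 1) p^a units.  So |G| is a product of numbers of this form
    ([card_abelian_units]).

    The integers that are such products have density zero
    ([local_product_density]).  Outside a set of small density, an integer t
    is not divisible by 2^B, nor by any Mersenne number 2^k - 1 with k >= K.
    Then fewer than B of its factors (p^k - 1) p^a are even, and the odd ones
    are Mersenne numbers below 2^K, so that t is a product of a bounded number
    of factors, each of the form (p^k - 1) p^a or a power of an integer below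
    2^K.  Among the integers near x, a proportion O(1 / log x) can be such a
    factor: this is Chebyshev's upper bound for the shifted primes p - 1
    ([chebyshev_dyadic]), while the other numbers are much rarer.  A product
    of b such sets has a proportion O((log log x)^b / log x) near x
    ([product_thinM]), which tends to zero.

    An integer t may be the order of many abelian groups, so a set of orders
    of density zero does not at once bound a number of groups.  An abelian
    group with invariant factors d_1, d_2, ..., d_r (each dividing the one
    before it) is determined by its order and by the chain (d_2, ..., d_r),
    and d_2 (d_2 ... d_r) divides its order.  The sum of the inverses of these
    weights over all chains converges, since in terms of e_i = d_i / d_(i+1)
    it is the product of the zeta(i) for i >= 2 ([chain_weight_sum_le]).
    Hence all but a small proportion of the groups have a chain in a fixed
    finite list ([chain_weight_tail]), and for these the number of groups is
    at most a constant times the number of orders ([size_codes_le]).  As the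
    cyclic groups already give at least floor(x) abelian groups of order at
    most x, the ratio tends to zero. *)

Set Implicit Arguments.
Unset Strict Implicit.
Unset Printing Implicit Defensive.

Import Order.TTheory GRing.Theory Num.Theory.
Import numFieldNormedType.Exports.

(** * Unit groups of finite commutative rings *)

(** The number of units of a finite local ring with residue field of order p^k
    and maximal ideal of order p^a. *)
Definition local_unit_order (w : nat) : Prop :=
  exists p k a, [/\ prime p, 0 < k & w = (p ^ k - 1) * p ^ a].

Definition local_product (n : nat) : Prop :=
  exists2 l : seq nat, {in l, forall w, local_unit_order w}
    & n = \prod_(w <- l) w.

Lemma local_product1 : local_product 1.
Proof. by exists [::]; rewrite ?big_nil. Qed.

Lemma local_productM m n :
  local_product m -> local_product n -> local_product (m * n).
Proof.
move=> [l lP ->] [r rP ->]; exists (l ++ r); rewrite ?big_cat//.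
by move=> w; rewrite mem_cat => /orP[/lP|/rP].
Qed.

Section UnitsOfCorners.
Local Open Scope ring_scope.
Variable R : finComNzRingType.
Implicit Types e f x y : R.

(** For an idempotent [e], the ideal [e R] is a ring with identity [e]: it is a
    direct factor of R.  Keeping it as a subset of R makes the induction on its
    cardinal in [card_corner_units] stay within one type. *)
Definition corner e : {set R} := [set x | e * x == x].

Definition corner_units e : {set R} :=
  [set x in corner e | [exists y in corner e, x * y == e]].

Lemma cornerP e x : reflect (e * x = x) (x \in corner e).
Proof. by rewrite inE; apply: eqP. Qed.

Lemma corner_unitsP e x :
  reflect (e * x = x /\ exists2 y, e * y = y & x * y = e) (x \in corner_units e).
Proof.
rewrite inE; apply: (iffP andP) => -[].
  move=> /cornerP ex /exists_inP[y /cornerP ey /eqP xy]; split=> //.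
  by exists y.
move=> ex [y ey xy]; split; first exact/cornerP.
by apply/exists_inP; exists y; [exact/cornerP|exact/eqP].
Qed.

(** The powers of [x] are eventually periodic with some period d, so that
    [x ^+ (2 * n) = x ^+ n] for any multiple n of d past the preperiod. *)
Lemma idempotent_power x : exists2 n, (0 < n)%N & x ^+ n * x ^+ n = x ^+ n.
Proof.
have [i [d d0 xid]] : exists i, exists2 d, (0 < d)%N & x ^+ (i + d) = x ^+ i.
  have : ~~ injectiveb (fun i : 'I_#|R|.+1 => x ^+ i).
    by apply/injectiveP => /leq_card; rewrite card_ord ltnn.
  move=> /injectivePn[i [j ij xij]].
  have /orP[lt|lt] : (i < j)%N || (j < i)%N by rewrite -neq_ltn.
    by exists i, (j - i)%N; rewrite ?subn_gt0// subnKC ?(ltnW lt).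
  by exists j, (i - j)%N; rewrite ?subn_gt0// subnKC ?(ltnW lt).
have per m : forall n, (i <= n)%N -> x ^+ (n + m * d) = x ^+ n.
  elim: m => [|m IH] n ni; first by rewrite addn0.
  rewrite mulSn addnA IH ?(leq_trans ni) ?leq_addr//.
  by rewrite -(subnKC ni) addnAC exprD xid -exprD.
exists (i.+1 * d)%N; first by rewrite muln_gt0.
rewrite -exprD per//; apply: (leq_trans (leqnSn i)); exact: leq_pmulr.
Qed.

Section Local.
Variable e : R.
Hypotheses (ee : e * e = e) (e0 : e != 0).
Hypothesis local : forall f, f * f = f -> e * f = f -> f = 0 \/ f = e.

Definition corner_nonunits : {set R} := corner e :\: corner_units e.

(** An idempotent power of [x] is 0 or [e], and in the second case [x] is
    invertible in [e R]. *)
Lemma nonunit_nilpotent x : x \in corner_nonunits -> exists n, x ^+ n = 0.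
Proof.
rewrite inE => /andP[xU /cornerP ex].
have [n n0 xn] := idempotent_power x.
have exn m : (0 < m)%N -> e * x ^+ m = x ^+ m.
  by case: m => // m _; rewrite exprS mulrA ex.
have [xn0|xne] := local xn (exn _ n0); first by exists n.
case/negP: xU; apply/corner_unitsP; split=> //.
exists (e * x ^+ n.-1); first by rewrite mulrA ee.
by rewrite mulrCA -exprS prednK// exn.
Qed.

Lemma nilpotent_nonunit x n :
  x \in corner e -> x ^+ n = 0 -> x \in corner_nonunits.
Proof.
move=> xe xn; rewrite inE xe andbT; apply/negP.
move=> /corner_unitsP[_ [y _ xy]]; move/eqP: e0; apply.
have idn m : e ^+ m.+1 = e.
  by elim: m => // m IH; rewrite exprS IH.
rewrite -(idn n) -xy exprS exprMn xn mul0r mulr0//.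
Qed.

Lemma corner_group_set : group_set (corner e).
Proof.
apply/group_setP; split; first by apply/cornerP; rewrite mulr0.
by move=> x y /cornerP ex /cornerP ey; apply/cornerP; rewrite mulrDr ex ey.
Qed.
Canonical corner_group := Group corner_group_set.

(** The nonunits are the nilpotents, and by the binomial formula these are
    closed under addition. *)
Lemma nonunits_group_set : group_set corner_nonunits.
Proof.
apply/group_setP; split.
  by apply: (@nilpotent_nonunit _ 1); [apply/cornerP; rewrite mulr0|].
move=> x y xM yM.
have [m xm] := nonunit_nilpotent xM; have [n yn] := nonunit_nilpotent yM.
apply: (@nilpotent_nonunit _ (m + n)).
  by apply: groupM; [move: xM|move: yM]; rewrite inE => /andP[].
rewrite /mulg/= exprDn big1// => i _.
have [ni|ni] := leqP n i; first by rewrite -(subnKC ni) exprD yn mul0r mulr0 mul0rn.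
rewrite -addnBA; last exact: ltnW.
by rewrite exprD xm !mul0r mul0rn.
Qed.
Canonical nonunits_group := Group nonunits_group_set.

(** If n is the least positive integer such that n e is not a unit, then p e is
    not a unit for a prime factor p of n (p is in fact n), so p e is nilpotent. *)
Lemma corner_residue_char :
  exists2 p, prime p & exists N, forall x, x \in corner e -> x *+ (p ^ N) = 0.
Proof.
have en m n : e *+ m * (e *+ n) = e *+ (m * n).
  by rewrite mulrnAl mulrnAr ee -mulrnA mulnC.
have eC n : e *+ n \in corner e by apply/cornerP; rewrite mulrnAr ee.
pose P n := (0 < n)%N && (e *+ n \in corner_nonunits).
(* #[e] is the additive order of e. *)
have [n /andP[n0 nM] nmin] : exists2 n, P n & forall m, P m -> (n <= m)%N.
  suff exP : exists n, P n by have [n] := ex_minnP exP; exists n.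
  exists #[e]%g; rewrite /P order_gt0 /=; apply: (@nilpotent_nonunit _ 1)=> //.
  by rewrite expr1 -FinRing.zmodXgE expg_order.
have n1 : (1 < n)%N.
  rewrite ltn_neqAle n0 andbT; apply/eqP => n1; move: nM; rewrite -n1 inE.
  case/andP => /negP[]; apply/corner_unitsP; split=> //; by exists e.
exists (pdiv n); first exact: pdiv_prime.
have pM : e *+ pdiv n \in corner_nonunits.
  have [d nE] := dvdnP (pdiv_dvd n).
  have d0 : (0 < d)%N by case: d nE n0 => // ->.
  apply/contraT => pU; have {pU} : e *+ pdiv n \in corner_units e.
    by move: pU; rewrite inE eC andbT negbK.
  move=> /corner_unitsP[_ [y ey py]].
  have dn : (d < n)%N by rewrite [X in (_ < X)%N]nE ltn_Pmulr// prime_gt1// pdiv_prime.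
  have dU : e *+ d \in corner_units e.
    apply: contraLR dn => dU; rewrite -leqNgt; apply: nmin.
    by rewrite /P d0 inE dU eC.
  move/corner_unitsP: dU => [_ [z ez dz]].
  move: nM; rewrite inE => /andP[/negP[]]; apply/corner_unitsP.
  split; first exact/cornerP; exists (z * y); first by rewrite mulrA ez.
  by rewrite {1}nE -en mulrACA dz py.
have [N pN] := nonunit_nilpotent pM; exists N.+1 => x /cornerP ex.
rewrite -ex -mulrnAl.
suff -> : e *+ pdiv n ^ N.+1 = (e *+ pdiv n) ^+ N.+1 by rewrite exprS pN mulr0 mul0r.
elim: N {pN} => [|N IH]; first by rewrite expn1 expr1.
by rewrite exprS -IH en -expnS.
Qed.

(** The additive group of [e R] is a p-group, hence so is its subgroup of
    nonunits, and the units are its complement. *)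
Lemma card_local_units : local_unit_order #|corner_units e|.
Proof.
have [p p_pr [N pN]] := corner_residue_char.
have pC : p.-nat #|corner e|.
  apply/pnatP; first exact: cardG_gt0.
  move=> q q_pr /(Cauchy q_pr)[x xe xq].
  have : (#[x]%g %| p ^ N)%N by rewrite order_dvdn FinRing.zmodXgE pN.
  by rewrite xq Euclid_dvdX// dvdn_prime2// => /andP[].
have C1 : (1 < #|corner e|)%N.
  rewrite (cardsD1 0) (cardsD1 e) !inE !mulr0 !eqxx e0 ee eqxx /=.
  by rewrite addnA leq_addr.
have [[k kE] [a aE]] : (exists k, #|corner e| = p ^ k)%N
    /\ (exists a, #|corner_nonunits| = p ^ a)%N.
  have [k kE] := p_natP pC; split; first by exists k.
  have : (#|corner_nonunits| %| #|corner e|)%N.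
    have sub : nonunits_group \subset corner_group by apply: finset.subsetDl.
    exact: cardSg sub.
  by rewrite kE => /(dvdn_pfactor _ _ p_pr)[a _ aE]; exists a.
have sub : corner_units e \subset corner e.
  by apply/fintype.subsetP => x; rewrite inE => /andP[].
have eU : e \in corner_units e by apply/corner_unitsP; split=> //; exists e.
have sum : (#|corner_units e| + p ^ a = p ^ k)%N.
  rewrite -aE -kE -(cardsID (corner_units e) (corner e)).
  by rewrite (finset.setIidPr sub).
have U0 : (0 < #|corner_units e|)%N by rewrite (cardD1 e) eU.
have ak : (a < k)%N by rewrite -(ltn_exp2l _ _ (prime_gt1 p_pr)) -sum -[X in (X < _)%N]add0n ltn_add2r.
exists p, (k - a)%N, a; rewrite subn_gt0; split=> //.
by rewrite mulnBl mul1n -expnD subnK ?(ltnW ak)// -sum addnK.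
Qed.
End Local.

(** Induction on the cardinal of [e R]: a nontrivial idempotent f of [e R]
    splits the units of [e R] into those of [f R] and of [(e - f) R]. *)
Lemma card_corner_units e : e * e = e -> local_product #|corner_units e|.
Proof.
have [n] := ubnP #|corner e|; elim: n e => // n IH e; rewrite ltnS => le ee.
have [e0|e0] := eqVneq e 0.
  suff -> : corner_units e = [set 0] by rewrite cards1; exact: local_product1.
  apply/finset.setP => x; rewrite e0 !inE mul0r eq_sym; apply: andb_idr => /eqP ->.
  by apply/exists_inP; exists 0; rewrite ?mul0r ?inE ?mulr0.
have [local|] := pselect (forall f, f * f = f -> e * f = f -> f = 0 \/ f = e).
  exists [:: #|corner_units e|]; last by rewrite big_seq1.
  by move=> w; rewrite inE => /eqP ->; apply: card_local_units.
move=> /existsNP[f /not_implyP[ff /not_implyP[ef /not_orP[f0 fe]]]].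
have [g gE] : exists g, g = e - f by exists (e - f).
have gg : g * g = g by rewrite gE mulrBl !mulrBr ee ef ff mulrC ef subrr subr0.
have eg : e * g = g by rewrite gE mulrBr ee ef.
have fg : f * g = 0 by rewrite gE mulrBr ff mulrC ef subrr.
have lt h k : h * h = h -> e * h = h -> k != 0 -> e * k = k -> h * k = 0 -> (#|corner h| < n)%N.
  move=> hh eh k0 ek hk; apply: leq_trans le; apply: proper_card.
  apply/properP; split.
    by apply/fintype.subsetP => x /cornerP hx; apply/cornerP; rewrite -hx mulrA eh.
  exists k; first exact/cornerP.
  by apply/cornerP; rewrite hk => /esym/eqP; apply/negP.
have g0 : g != 0 by rewrite gE subr_eq0; apply/eqP => /esym.
have -> : #|corner_units e| = (#|corner_units f| * #|corner_units g|)%N.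
  rewrite -cardsX.
  rewrite -(@card_in_imset _ _ (fun z => (f * z, g * z)) (corner_units e)); last first.
    move=> x y /corner_unitsP[ex _] /corner_unitsP[ey _] [fxy gxy].
    have efg : e = f + g by rewrite gE addrC subrK.
    by rewrite -ex -ey efg !mulrDl fxy gxy.
  congr #|pred_of_set _|; apply/finset.setP => -[y z]; apply/imsetP/idP.
    move=> [x /corner_unitsP[ex [t et xt]] [-> ->]]; rewrite inE /=.
    apply/andP; split; apply/corner_unitsP; split.
    - by rewrite mulrA ff.
    - exists (f * t); first by rewrite mulrA ff.
      by rewrite mulrACA ff xt mulrC.
    - by rewrite mulrA gg.
    - exists (g * t); first by rewrite mulrA gg.
      by rewrite mulrACA gg xt mulrC.
  rewrite inE => /andP[/corner_unitsP[/= fy [s fs ys]] /corner_unitsP[/= gz [t gt zt]]].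
  have fz : f * z = 0 by rewrite -gz mulrA fg mul0r.
  have gy : g * y = 0 by rewrite -fy mulrA [g * f]mulrC fg mul0r.
  have gs : g * s = 0 by rewrite -fs mulrA [g * f]mulrC fg mul0r.
  have ft : f * t = 0 by rewrite -gt mulrA fg mul0r.
  exists (y + z); last by rewrite !mulrDr fy gz fz gy addr0 add0r.
  apply/corner_unitsP; split.
    by rewrite -fy -gz mulrDr !mulrA ef eg.
  exists (s + t); first by rewrite -fs -gt mulrDr !mulrA ef eg.
  rewrite mulrDl !mulrDr ys zt.
  have -> : y * t = 0 by rewrite -fy mulrAC ft mul0r.
  have -> : z * s = 0 by rewrite -gz mulrAC gs mul0r.
  by rewrite addr0 add0r gE addrC subrK.
apply: local_productM; apply: IH => //.
  exact: (lt f g).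
by apply: (lt g f) => //; [exact/eqP|rewrite mulrC].
Qed.
End UnitsOfCorners.

Section UnitSpan.
Local Open Scope ring_scope.
Variables (S : pzRingType) (gT : finGroupType) (f : gT -> S) (n : nat).
Hypotheses (n0 : (0 < n)%N) (nS : n%:R = 0 :> S) (nontriv : 1 != 0 :> S).
Hypotheses (abel : abelian [set: gT]) (f1 : f 1%g = 1).
Hypothesis fM : {morph f : a b / (a * b)%g >-> a * b}.

(** When f enumerates the units of a ring of positive characteristic, the sums
    of units form a subring, because - x is a multiple of x. *)
Definition unit_span : {pred S} :=
  fun x => `[< exists l : seq gT, x = \sum_(g <- l) f g >].

Lemma unit_spanP x :
  reflect (exists l : seq gT, x = \sum_(g <- l) f g) (x \in unit_span).
Proof. exact: asboolP. Qed.

Lemma unit_span_subring : subring_closed unit_span.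
Proof.
have nx (x : S) : x *+ n = 0 by rewrite -mulr_natr nS mulr0.
have opp (x : S) : - x = x *+ n.-1.
  by apply/eqP; rewrite eq_sym -addr_eq0 -mulrSr prednK// nx.
have D x y : x \in unit_span -> y \in unit_span -> x + y \in unit_span.
  move=> /unit_spanP[l ->] /unit_spanP[r ->]; apply/unit_spanP.
  by exists (l ++ r); rewrite big_cat.
have MN x k : x \in unit_span -> x *+ k \in unit_span.
  move=> xs; elim: k => [|k IH]; last by rewrite mulrS D.
  by apply/unit_spanP; exists [::]; rewrite big_nil mulr0n.
split.
- by apply/unit_spanP; exists [:: 1%g]; rewrite big_seq1.
- by move=> x y xs ys; rewrite opp D// MN.
move=> x y /unit_spanP[l ->] /unit_spanP[r ->]; apply/unit_spanP.
exists [seq (a * b)%g | a <- l, b <- r]; rewrite big_allpairs_dep mulr_suml.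
by apply: eq_bigr => a _; rewrite mulr_sumr; apply: eq_bigr => b _; rewrite fM.
Qed.

HB.instance Definition _ :=
  GRing.isSubringClosed.Build S unit_span unit_span_subring.

Record unit_ring := UnitRing { span_val : S; _ : span_val \in unit_span }.
HB.instance Definition _ := [isSub for span_val].
HB.instance Definition _ := [Choice of unit_ring by <:].
HB.instance Definition _ :=
  GRing.SubChoice_isSubPzRing.Build S unit_span unit_ring unit_span_subring.

Lemma unit_ring_mulC : commutative (@GRing.mul unit_ring).
Proof.
move=> x y; apply: val_inj; rewrite !rmorphM /=.
case: x y => x /= /unit_spanP[l ->] [y /= /unit_spanP[r ->]].
rewrite mulr_suml mulr_sumr; apply: eq_bigr => a _.
rewrite mulr_suml mulr_sumr; apply: eq_bigr => b _.
by rewrite -!fM (centsP abel)// inE.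
Qed.
HB.instance Definition _ :=
  GRing.PzRing_hasCommutativeMul.Build unit_ring unit_ring_mulC.

Lemma unit_ring_neq0 : (1 : unit_ring) != 0.
Proof. by apply/eqP => /(congr1 val) /eqP; rewrite rmorph1 rmorph0; apply/negP. Qed.
HB.instance Definition _ :=
  GRing.PzSemiRing_isNonZero.Build unit_ring unit_ring_neq0.

(** Coefficients of sums of units may be reduced modulo n, hence finiteness. *)
Lemma unit_ring_coeffs (x : unit_ring) :
  exists c : {ffun gT -> 'I_n}, span_val x = \sum_g f g *+ c g.
Proof.
case: x => x /= /unit_spanP[l ->].
exists [ffun g => Ordinal (ltn_pmod (count_mem g l) n0)].
rewrite [RHS](eq_bigr (fun g => f g *+ count_mem g l)); last first.
  move=> g _; rewrite ffunE /= {2}(divn_eq (count_mem g l) n).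
  by rewrite mulrnDr mulnC mulrnA -(mulr_natr _ n) nS mulr0 mul0rn add0r.
elim: l => [|a l IH]; first by rewrite big_nil big1.
rewrite big_cons IH; under [RHS]eq_bigr => g _ do rewrite /= mulrnDr.
rewrite big_split /=; congr (_ + _).
by rewrite (bigD1 a)//= eqxx big1 ?addr0// => g /negPf ga; rewrite eq_sym ga.
Qed.

Definition coeffs x := sval (cid (unit_ring_coeffs x)).

Definition of_coeffs (c : {ffun gT -> 'I_n}) : unit_ring :=
  insubd 0 (\sum_g f g *+ c g).

Lemma coeffsK : cancel coeffs of_coeffs.
Proof.
move=> x; apply: val_inj; rewrite /of_coeffs /coeffs.
by case: cid => c /= <-; rewrite valKd.
Qed.
HB.instance Definition _ := CanIsCountable coeffsK.
HB.instance Definition _ :=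
  fintype.isFinite.Build unit_ring (pcan_enumP (can_pcan coeffsK)).

(** The units of S and their inverses lie in the subring of sums of units, so the
    two rings have the same units. *)
Lemma card_unit_group : injective f ->
  (forall u : S, invertible u <-> exists a : gT, f a = u) ->
  local_product #|gT|.
Proof.
move=> fI fU.
have fS a : f a \in unit_span by apply/unit_spanP; exists [:: a]; rewrite big_seq1.
pose F a : unit_ring := UnitRing (fS a).
have FI : injective F by move=> a b [/fI].
suff -> : #|gT| = #|corner_units (1 : unit_ring)|.
  by apply: card_corner_units; rewrite mulr1.
rewrite -(card_codom FI); apply: eq_card => x; apply/idP/corner_unitsP.
  move=> /codomP[a ->]; split; first by rewrite mul1r.
  exists (F a^-1%g); first by rewrite mul1r.
  by apply: val_inj; rewrite rmorphM rmorph1 /= -fM mulgV.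
case=> _ [y _ xy].
have /fU[a fa] : invertible (val x).
  have yx : y * x = 1 by rewrite mulrC.
  by exists (val y); split; [move/(congr1 val): xy|move/(congr1 val): yx].
by apply/codomP; exists a; apply: val_inj.
Qed.
End UnitSpan.

Section AbelianUnits.
Local Open Scope ring_scope.

Lemma card_abelian_units (gT : finGroupType) :
  abelian_units_positive_characteristic gT -> local_product #|gT|.
Proof.
move=> [abel [S [[n n0 Sn] [f [fI fM fU]]]]].
have nS : n%:R = 0 :> S by apply/Sn.
have f1 : f 1%g = 1.
  have [_ /(_ (ex_intro _ 1%g erefl)) [v [fv _]]] := fU (f 1%g).
  by rewrite -[LHS]mulr1 -fv mulrA -fM mulg1.
(* The only unit of the trivial ring is 0, and 1 is an empty product. *)
have [S0|nontriv] := eqVneq (1 : S) 0; last first.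
  exact: (card_unit_group n0 nS nontriv abel f1 fM fI fU).
suff -> : #|gT| = 1%N by exact: local_product1.
apply/eqP/fintype1P; exists 1%g => x; apply: fI.
by rewrite -[f x]mulr1 -[RHS]mulr1 S0 !mulr0.
Qed.

End AbelianUnits.

(** * Chebyshev's bound and logarithmically thin sets *)

(** Sizes of sets of integers are bounded through lists that cover them, so
    that products and unions need no care about repetitions. *)
Definition dyadic_cover (E : nat -> Prop) (j : nat) (s : seq nat) : Prop :=
  forall w, E w -> 2 ^ j <= w < 2 ^ j.+1 -> w \in s.

(** The number of elements between x and 2 x is O(x / log x). *)
Definition log_thin (E : nat -> Prop) : Prop :=
  exists C, forall j, exists2 s, dyadic_cover E j s
    & j.+1 * size s <= C * 2 ^ j.

Lemma log_thin_sub (E F : nat -> Prop) :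
  (forall w, E w -> F w) -> log_thin F -> log_thin E.
Proof.
move=> EF [C FC]; exists C => j; have [s sF sC] := FC j.
by exists s => // w /EF; apply: sF.
Qed.

Lemma log_thinU (E F : nat -> Prop) :
  log_thin E -> log_thin F -> log_thin (fun w => E w \/ F w).
Proof.
move=> [C EC] [D FD]; exists (C + D) => j.
have [s sE sC] := EC j; have [t tF tD] := FD j.
exists (s ++ t); last by rewrite size_cat mulnDr mulnDl leq_add.
by move=> w [/sE|/tF] wP /wP; rewrite mem_cat => ->; rewrite ?orbT.
Qed.

Lemma prime_dvd_prod_primes p (s : seq nat) :
  prime p -> {in s, forall q, prime q} -> p %| \prod_(q <- s) q -> p \in s.
Proof.
move=> p_pr; elim: s => [|q s IH] sP; first by rewrite big_nil Euclid_dvd1.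
rewrite big_cons Euclid_dvdM// inE => /orP[|pd].
  by rewrite dvdn_prime2 ?(sP q) ?mem_head// => ->.
by rewrite IH ?orbT// => r rs; apply: sP; rewrite inE rs orbT.
Qed.

Lemma prod_primes_dvd (s : seq nat) m : uniq s ->
  {in s, forall p, prime p} -> {in s, forall p, p %| m} ->
  \prod_(p <- s) p %| m.
Proof.
elim: s => [|p s IH] /=; first by rewrite big_nil dvd1n.
move=> /andP[ps us] sP sd.
have sub q : q \in s -> q \in p :: s by rewrite inE orbC => ->.
rewrite big_cons Gauss_dvd.
  by rewrite sd ?mem_head// IH// => q /sub; [apply: sP|apply: sd].
rewrite prime_coprime ?sP ?mem_head//; apply: contra ps.
by apply: prime_dvd_prod_primes => [|q /sub]; apply: sP; rewrite ?mem_head.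
Qed.

Lemma bin_le_exp2 n k : 'C(n, k) <= 2 ^ n.
Proof.
have [kn|nk] := leqP k n; last by rewrite bin_small.
rewrite -[2]/(1 + 1) expnDn (bigD1 (Ordinal (kn : k < n.+1)))//= !exp1n !muln1.
exact: leq_addr.
Qed.

Lemma prime_dvd_fact p n : prime p -> (p %| n`!) = (p <= n).
Proof.
move=> p_pr; apply/idP/idP; last by move=> pn; rewrite dvdn_fact// prime_gt0.
elim: n => [|n IH]; first by rewrite fact0 Euclid_dvd1.
by rewrite factS Euclid_dvdM// => /orP[/dvdn_leq->//|/IH/leqW].
Qed.

Definition primes_between m n := [seq p <- iota m.+1 (n - m) | prime p].

Lemma primes_betweenP m n p :
  reflect [/\ prime p, m < p & p <= n] (p \in primes_between m n).
Proof.
rewrite mem_filter mem_iota; apply: (iffP and3P) => -[p_pr mp pn].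
  by split=> //; lia.
by split=> //; lia.
Qed.

(** The primes p with [2 ^ j < p <= 2 ^ j.+1] divide the central binomial
    coefficient, which is at most [2 ^ 2 ^ j.+1], and each exceeds [2 ^ j]. *)
Lemma chebyshev_dyadic j :
  j * size (primes_between (2 ^ j) (2 ^ j.+1)) <= 2 ^ j.+1.
Proof.
set s := primes_between _ _.
have dv : \prod_(p <- s) p %| 'C(2 ^ j.+1, 2 ^ j).
  apply: prod_primes_dvd => [|p|p] /=; first by rewrite filter_uniq ?iota_uniq.
    by case/primes_betweenP.
  move=> /primes_betweenP[p_pr lo hi].
  have le : 2 ^ j <= 2 ^ j.+1 by rewrite leq_exp2l.
  have : p %| (2 ^ j.+1)`! by rewrite prime_dvd_fact.
  rewrite -(bin_fact le) !Euclid_dvdM//.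
  have -> : 2 ^ j.+1 - 2 ^ j = 2 ^ j by rewrite expnS; lia.
  by rewrite !prime_dvd_fact// leqNgt lo !orbF.
rewrite -(@leq_exp2l 2)//; apply: leq_trans (bin_le_exp2 _ (2 ^ j)).
apply: leq_trans (dvdn_leq _ dv); last by rewrite bin_gt0 leq_exp2l.
rewrite expnM.
have : {in s, forall p, 2 ^ j <= p} by move=> p /primes_betweenP[_ /ltnW].
elim: (s) => [|p r IH] rP; first by rewrite big_nil.
rewrite big_cons /= expnS leq_mul//; first exact: rP (mem_head _ _).
by apply: IH => q qr; apply: rP; rewrite inE qr orbT.
Qed.

(** With q the quotient of t by b, [t.+1 <= b * q.+1 <= b * 2 ^ q]. *)
Lemma poly_le_exp2 b : exists C, forall t, t.+1 ^ b <= C * 2 ^ t.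
Proof.
case: b => [|b]; first by exists 1 => t; rewrite mul1n expn0 expn_gt0.
exists (b.+1 ^ b.+1) => t.
apply: (@leq_trans ((b.+1 * 2 ^ (t %/ b.+1)) ^ b.+1)).
  rewrite leq_exp2r//; apply: leq_trans (ltn_ceil t (ltn0Sn b)) _.
  by rewrite mulnC leq_mul// ltn_expl.
by rewrite expnMn -expnM leq_mul// leq_exp2l// leq_trunc_div.
Qed.

Lemma shifted_primes_thin : log_thin (fun w => prime w.+1).
Proof.
exists 4 => j; exists [seq p.-1 | p <- primes_between (2 ^ j) (2 ^ j.+1)].
  move=> w w_pr /andP[lo hi]; apply/mapP; exists w.+1 => //.
  by apply/primes_betweenP; split.
have : size (primes_between (2 ^ j) (2 ^ j.+1)) <= 2 ^ j.
  rewrite size_filter; apply: leq_trans (count_size _ _) _.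
  by rewrite size_iota expnS; lia.
have := chebyshev_dyadic j; rewrite size_map [X in _ <= X]expnS.
by rewrite [X in _ -> _ -> X <= _]mulSn; lia.
Qed.

(** Apart from the shifted primes, p^(k+a) with k + a >= 2 is at most twice the
    number, so p is bounded by a square root and k and a by a logarithm. *)
Lemma local_unit_order_thin : log_thin local_unit_order.
Proof.
pose F w := exists p k a, [/\ 1 < p, 0 < k, 1 < k + a & w = (p ^ k - 1) * p ^ a].
suff FT : log_thin F.
  apply: log_thin_sub (log_thinU shifted_primes_thin FT) => w [p [k [a [p_pr k0 ->]]]].
  have [ka|] := ltnP 1 (k + a).
    by right; exists p, k, a; split=> //; exact: prime_gt1.
  case: k a k0 => [//|[|k]] [|a]//= _ _; left.
  by rewrite expn1 expn0 muln1 subn1 prednK// prime_gt0.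
have [C CP] := poly_le_exp2 3.
exists (2 * 18 * C) => j.
exists [seq (x.1.1 ^ x.1.2 - 1) * x.1.1 ^ x.2 |
   x <- [seq (y, a) | y <- [seq (p, k) | p <- iota 0 (2 ^ (uphalf j).+1), k <- iota 0 j.+2],
                      a <- iota 0 j.+2]].
  move=> _ [p [k [a [p1 k0 ka ->]]]] /andP[_ hi].
  have lt : p ^ (k + a) < 2 ^ j.+2.
    have : 1 < p ^ k by rewrite -{1}(exp1n k) ltn_exp2r.
    rewrite expnD expnS; have : 0 < p ^ a by rewrite expn_gt0 ltnW.
    by move: hi; nia.
  have ltka : k + a < j.+2.
    rewrite -(@ltn_exp2l 2)//; apply: leq_ltn_trans lt.
    by rewrite leq_exp2r// addn_gt0 k0.
  have ltp : p < 2 ^ (uphalf j).+1.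
    rewrite -(@ltn_exp2r _ _ 2)// -expnM; apply: (@leq_ltn_trans (p ^ (k + a))).
      by rewrite leq_exp2l.
    by apply: leq_trans lt _; rewrite leq_exp2l//; lia.
  apply/mapP; exists (p, k, a) => //.
  have sq x y : x < y -> x \in iota 0 y by rewrite mem_iota.
  apply: (allpairs_f pair); last by apply: sq; lia.
  by apply: (allpairs_f pair); apply: sq => //; lia.
rewrite size_map !size_allpairs !size_iota.
have -> : 2 ^ j = 2 ^ uphalf j * 2 ^ j./2.
  by rewrite -expnD; congr (2 ^ _); lia.
(* There are at most [2 * 2 ^ uphalf j * j.+2 ^ 2] triples, and the polynomial
   factor is absorbed by [2 ^ j./2]. *)
have le : j.+1 * (j.+2 * j.+2) <= 18 * (j./2).+1 ^ 3.
  have h2 : j.+1 <= 2 * (j./2).+1 by lia.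
  have h3 : j.+2 <= 3 * (j./2).+1 by lia.
  apply: leq_trans (leq_mul h2 (leq_mul h3 h3)) _.
  by rewrite !expnS expn0; lia.
rewrite expnS.
have -> : j.+1 * (2 * 2 ^ uphalf j * j.+2 * j.+2)
    = 2 * 2 ^ uphalf j * (j.+1 * (j.+2 * j.+2)) by ring.
have -> : 2 * 18 * C * (2 ^ uphalf j * 2 ^ j./2)
    = 2 * 2 ^ uphalf j * (18 * (C * 2 ^ j./2)) by ring.
by rewrite leq_mul2l (leq_trans le) ?orbT// leq_mul2l CP orbT.
Qed.

(** * Product sets of thin sets *)

(** Bounds log log x for x in the j-th dyadic interval, and also the harmonic
    sum of order j ([harmonic_le_loglog]). *)
Definition loglog (j : nat) : nat := (trunc_log 2 j.+1).+2.

Lemma leq_loglog i j : i <= j -> loglog i <= loglog j.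
Proof. by move=> ij; rewrite /loglog !ltnS leq_trunc_log. Qed.

Section Harmonic.
Local Open Scope ring_scope.

(** Doubling the number of terms of the harmonic sum adds at most 1. *)
Lemma harmonic_le_loglog s : \sum_(i < s.+1) (i.+1%:R^-1 : rat) <= (loglog s)%:R.
Proof.
have pow t : \sum_(i < 2 ^ t) (i.+1%:R^-1 : rat) <= t.+1%:R.
  elim: t => [|t IH]; first by rewrite big_ord1 invr1.
  rewrite expnS mul2n -addnn big_split_ord /= -[t.+2]addn1 natrD lerD//.
  apply: (@le_trans _ _ (\sum_(i < 2 ^ t) ((2 ^ t)%:R^-1 : rat))).
    apply: ler_sum => i _; rewrite lef_pV2 ?posrE ?ltr0n ?expn_gt0//.
    by rewrite ler_nat -addnS leq_addr.
  by rewrite sumr_const card_ord -[X in X <= _]mulr_natr mulVf.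
apply: le_trans (pow (trunc_log 2 s.+1).+1).
have le : (s.+1 <= 2 ^ (trunc_log 2 s.+1).+1)%N by apply: ltnW; apply: trunc_log_ltn.
rewrite -(subnKC le) big_split_ord /= lerDl.
by apply: sumr_ge0 => i _; rewrite invr_ge0 ler0n.
Qed.

(** 1/(a b) = (1/a + 1/b)/(a + b), and here a + b is constant. *)
Lemma sum_inv_convolution s :
  \sum_(i < s.+1) ((i.+1 * (s - i).+1)%:R^-1 : rat)
  = 2 * (\sum_(i < s.+1) i.+1%:R^-1) / s.+2%:R.
Proof.
have rev : \sum_(i < s.+1) ((s - i).+1%:R^-1 : rat) = \sum_(i < s.+1) i.+1%:R^-1.
  rewrite (reindex_inj rev_ord_inj) /=; apply: eq_bigr => i _.
  by rewrite subSS subKn// -ltnS.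
rewrite mulr_natl mulr2n -{1}rev -big_split /= mulr_suml; apply: eq_bigr => i _.
have -> : s.+2 = (i.+1 + (s - i).+1)%N by have := ltn_ord i; lia.
move: (s - i)%N => k; rewrite natrM natrD.
have : (0 : rat) < i.+1%:R by rewrite ltr0n.
have : (0 : rat) < k.+1%:R by rewrite ltr0n.
move: (i.+1%:R : rat) (k.+1%:R : rat) => x y y0 x0.
by field; rewrite !gt_eqF ?addr_gt0.
Qed.

End Harmonic.

(** The size of a product set in a dyadic interval is a convolution of the
    sizes of its factors; for densities O(1/i) this costs a harmonic sum. *)
Lemma convolution_bound (e f : nat -> nat) C D s :
  (forall i, i <= s -> i.+1 * e i <= C * 2 ^ i) ->
  (forall k, k <= s -> k.+1 * f k <= D * 2 ^ k) ->
  s.+2 * \sum_(i < s.+1) e i * f (s - i) <= 2 * (C * D) * loglog s * 2 ^ s.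
Proof.
move=> eC fD; rewrite -(ler_nat rat).
have term (i : 'I_s.+1) : ((e i * f (s - i))%N%:R <=
    (C * D * 2 ^ s)%N%:R * (i.+1 * (s - i).+1)%N%:R^-1 :> rat)%R.
  have is_ : i <= s by rewrite -ltnS.
  rewrite ler_pdivlMr ?ltr0n// -natrM ler_nat.
  rewrite mulnC mulnACA.
  apply: leq_trans (leq_mul (eC _ is_) (fD _ (leq_subr _ _))) _.
  by rewrite mulnACA -expnD subnKC.
have : ((\sum_(i < s.+1) e i * f (s - i))%N%:R <= (C * D * 2 ^ s)%N%:R *
   \sum_(i < s.+1) (i.+1 * (s - i).+1)%N%:R^-1 :> rat)%R.
  by rewrite natr_sum mulr_sumr; apply: ler_sum => i _; apply: term.
rewrite sum_inv_convolution mulrA ler_pdivlMr ?ltr0n// mulrC -natrM => /le_trans; apply.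
rewrite (_ : 2 * (C * D) * loglog s * 2 ^ s = C * D * 2 ^ s * (2 * loglog s)); last by ring.
by rewrite !natrM !ler_wpM2l ?mulr_ge0 ?ler0n// harmonic_le_loglog.
Qed.

(** A proportion O((log log x)^b / log x) of the integers between x and 2 x, as
    for a product of b thin sets. *)
Definition product_thin (b : nat) (E : nat -> Prop) : Prop :=
  exists C, forall j, exists2 s, dyadic_cover E j s
    & j.+1 * size s <= C * loglog j ^ b * 2 ^ j.

Definition product_set (E F : nat -> Prop) (n : nat) : Prop :=
  exists u v, [/\ E u, F v & n = u * v].

Fixpoint products (E : nat -> Prop) (b : nat) : nat -> Prop :=
  if b is b'.+1 then product_set E (products E b') else eq 1.

Definition convolution_cover (A B : nat -> seq nat) (s : nat) : seq nat :=
  flatten [seq [seq u * v | u <- A i, v <- B (s - i)] | i <- iota 0 s.+1].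

Lemma size_convolution_cover A B s :
  size (convolution_cover A B s)
  = \sum_(i < s.+1) size (A i) * size (B (s - i)).
Proof.
rewrite size_flatten /shape -map_comp sumnE big_map
  -(big_mkord xpredT (fun i => size (A i) * size (B (s - i)))).
by rewrite /index_iota subn0; apply: eq_bigr => i _; rewrite /= size_allpairs.
Qed.

Lemma mem_convolution_cover A B i k u v :
  u \in A i -> v \in B k -> u * v \in convolution_cover A B (i + k).
Proof.
move=> uA vB; apply/flatten_mapP; exists i; first by rewrite mem_iota; lia.
by rewrite addKn; apply: allpairs_f.
Qed.

(** If u and v are in the i-th and k-th dyadic intervals, then u v is in that
    of index i + k or i + k + 1. *)
Lemma product_thinM b E F :
  log_thin E -> product_thin b F -> product_thin b.+1 (product_set E F).
Proof.
move=> [C EC] [D FD].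
have /choice[A AP] j : exists s, dyadic_cover E j s /\ j.+1 * size s <= C * 2 ^ j.
  by have [s] := EC j; exists s.
have /choice[B BP] j : exists s,
    dyadic_cover F j s /\ j.+1 * size s <= D * loglog j ^ b * 2 ^ j.
  by have [s] := FD j; exists s.
have conv s : s.+2 * size (convolution_cover A B s)
    <= 2 * C * D * loglog s ^ b.+1 * 2 ^ s.
  rewrite size_convolution_cover.
  have -> : 2 * C * D * loglog s ^ b.+1 * 2 ^ s
      = 2 * (C * (D * loglog s ^ b)) * loglog s * 2 ^ s by rewrite expnS; ring.
  apply: (@convolution_bound (size \o A) (size \o B)) => i is_ /=; first by have [] := AP i.
  apply: leq_trans (proj2 (BP i)) _; rewrite leq_mul2r leq_mul2l.
  suff -> : loglog i ^ b <= loglog s ^ b by rewrite !orbT.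
  by case: (b) => // b'; rewrite leq_exp2r// leq_loglog.
exists (4 * C * D) => s.
(* For s = 0 the two lists coincide. *)
exists (convolution_cover A B s ++ convolution_cover A B s.-1).
  move=> _ [u [v [Eu Fv ->]]] /andP[lo hi].
  have /andP[u0 v0] : (0 < u) && (0 < v).
    by rewrite -muln_gt0; apply: leq_trans lo; rewrite expn_gt0.
  have := trunc_log_bounds (isT : 1 < 2) u0; have := trunc_log_bounds (isT : 1 < 2) v0.
  set k := trunc_log 2 v; set i := trunc_log 2 u => /= vk ui.
  have uA : u \in A i by have [cov _] := AP i; apply: cov.
  have vB : v \in B k by have [cov _] := BP k; apply: cov.
  have uv := mem_convolution_cover uA vB.
  have [ulo uhi] := andP ui; have [vlo vhi] := andP vk.
  have iks : i + k <= s.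
    rewrite -ltnS -(@ltn_exp2l 2)// expnD.
    by apply: leq_ltn_trans hi; apply: leq_mul.
  have sik : s < (i + k).+2.
    rewrite -(@ltn_exp2l 2)//; apply: (leq_ltn_trans lo).
    by rewrite -addSn -addnS expnD; apply: ltn_mul.
  rewrite mem_cat; apply/orP.
  have [<-|] := eqVneq (i + k) s; [by left|right].
  by have <- : i + k = s.-1 by lia.
rewrite size_cat mulnDr.
have le1 : s.+1 * size (convolution_cover A B s) <= 2 * C * D * loglog s ^ b.+1 * 2 ^ s.
  by apply: leq_trans (conv s); rewrite leq_mul2r leqnSn orbT.
have le2 : s.+1 * size (convolution_cover A B s.-1) <= 2 * C * D * loglog s ^ b.+1 * 2 ^ s.
  apply: (@leq_trans (s.-1.+2 * size (convolution_cover A B s.-1))).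
    by apply: leq_mul => //; lia.
  apply: leq_trans (conv _) _; apply: leq_mul; last by rewrite leq_exp2l ?leq_pred.
  by apply: leq_mul => //; rewrite leq_exp2r// leq_loglog// leq_pred.
apply: leq_trans (leq_add le1 le2) _.
by move: (loglog s ^ _) => l; lia.
Qed.

Lemma products_thin E b : log_thin E -> product_thin b (products E b).
Proof.
move=> ET; elim: b => [|b IH]; last exact: product_thinM.
exists 1 => -[|j]; first by exists [:: 1] => // w <-.
exists [::]; last by rewrite muln0.
by move=> w <-; rewrite -[1](expn0 2) leq_exp2l.
Qed.

Definition sparse (E : nat -> Prop) : Prop :=
  forall m, exists j0, forall j, j0 <= j ->
    exists2 s, dyadic_cover E j s & m * size s <= 2 ^ j.

(** With t the logarithm of j, t^b / 2^t tends to zero: [poly_le_exp2] for the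
    exponent b + 1 leaves a factor 1/t to spare. *)
Lemma product_thin_sparse b E : product_thin b E -> sparse E.
Proof.
move=> [C EC] m; have [D DP] := poly_le_exp2 b.+1.
pose K := (C * D * 2).+1 * m.
exists (2 ^ K) => j Kj; have [s sE sC] := EC j; exists s => //.
set t := trunc_log 2 j.+1.
have Kt : K <= t by apply: trunc_log_max => //; apply: leqW.
have tj : 2 ^ t <= j.+1 by apply: trunc_logP.
have main : t.+2 * size s <= C * D * 2 * 2 ^ j.
  rewrite -(@leq_pmul2l (2 ^ t)) ?expn_gt0//.
  apply: (@leq_trans (t.+2 * (C * t.+2 ^ b * 2 ^ j))).
    by rewrite mulnCA leq_mul2l (leq_trans _ sC) ?orbT// leq_mul2r tj orbT.
  have -> : t.+2 * (C * t.+2 ^ b * 2 ^ j) = C * 2 ^ j * t.+2 ^ b.+1.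
    by rewrite expnS; ring.
  apply: leq_trans (leq_mul (leqnn _) (DP t.+1)) _.
  by rewrite expnS; move: (2 ^ t) (2 ^ j) => x y; lia.
rewrite -(@leq_pmul2l (C * D * 2).+1)// mulnA.
apply: (@leq_trans (t.+2 * size s)).
  by apply: leq_mul => //; apply: leq_trans Kt _; apply: leqW.
by apply: leq_trans main _; apply: leq_mul.
Qed.

(** The upper density of T is at most 1/m. *)
Definition density_at_most (m : nat) (T : nat -> Prop) : Prop :=
  exists N, forall n, N <= n -> exists2 s : seq nat,
    m * size s <= n & forall t, T t -> 0 < t <= n -> t \in s.

(** Sum over the dyadic intervals up to n; the first ones contribute a constant. *)
Lemma sparse_density E : sparse E -> forall m, density_at_most m E.
Proof.
move=> ES m; have [j0 /= jP] := ES (4 * m).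
have /choice[A AP] j : exists s, j0 <= j ->
    dyadic_cover E j s /\ 4 * m * size s <= 2 ^ j.
  have [/jP[s]|] := leqP j0 j; [by exists s|by exists [::]].
exists (2 * m * 2 ^ j0).+1 => n nN; set t := trunc_log 2 n.
have n0 : 0 < n by apply: leq_ltn_trans nN.
exists (iota 0 (2 ^ j0) ++ flatten [seq A j | j <- iota j0 (t.+1 - j0)]); last first.
  move=> w Ew /andP[w0 wn]; rewrite mem_cat mem_iota /=.
  have [//|jw] := ltnP w (2 ^ j0); apply/orP; right.
  have le : j0 <= trunc_log 2 w by apply: trunc_log_max.
  apply/flatten_mapP; exists (trunc_log 2 w).
    by rewrite mem_iota le /=; have := leq_trunc_log 2 wn; rewrite -/t; lia.
  have [cov _] := AP _ le; apply: cov => //; exact: trunc_log_bounds.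
rewrite size_cat size_iota size_flatten /shape -map_comp sumnE big_map.
have sum : 4 * m * \sum_(j <- iota j0 (t.+1 - j0)) size (A j) <= 2 ^ t.+1.
  have [le|] := leqP j0 t.+1; last first.
    by move=> /ltnW; rewrite -subn_eq0 => /eqP ->; rewrite big_nil muln0.
  rewrite -[X in 2 ^ X](subnKC le); move: (t.+1 - j0) => d.
  elim: d => [|d IH]; first by rewrite big_nil muln0.
  rewrite -[in iota _ _]addn1 iotaD big_cat big_seq1 /= mulnDr addnS expnS mul2n -addnn.
  by apply: leq_add => //; have [] := AP _ (leq_addr d j0).
have tn : 2 ^ t <= n by apply: trunc_logP.
move: sum; rewrite expnS /comp; move: (2 ^ t) (\sum_(j <- _) _) tn => x y tn sum.
rewrite mulnDr; move: nN; move: (2 ^ j0) => z; lia.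
Qed.

Definition multiples d n := [seq d * i | i <- iota 1 (n %/ d)].

Lemma mem_multiples d n t : d %| t -> 0 < t <= n -> t \in multiples d n.
Proof.
move=> /dvdnP[i ->]; rewrite muln_gt0 => /andP[/andP[i0 d0] le].
by apply/mapP; exists i; rewrite 1?mulnC// mem_iota i0 ltnS leq_divRL.
Qed.

Lemma size_multiples d n : size (multiples d n) = n %/ d.
Proof. by rewrite size_map size_iota. Qed.

(** A geometric sum; rounding does no harm, since twice the quotient by 2^(i+1)
    is at most the quotient by 2^i. *)
Lemma sum_divn_exp2 K t n :
  \sum_(i <- iota K.+1 t) n %/ 2 ^ i <= n %/ 2 ^ K.
Proof.
elim: t K => [|t IH] K; first by rewrite big_nil.
rewrite big_cons; apply: leq_trans (leq_add (leqnn _) (IH K.+1)) _.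
have := leq_trunc_div (n %/ 2 ^ K) 2.
by rewrite -divnMA -expnSr; lia.
Qed.

(** * Products of orders of local unit groups have density zero *)

(** Groups the equal factors, so that a product of any number of integers below
    L is a product of L powers. *)
Lemma prod_seq_count L (l : seq nat) : {in l, forall w, w < L} ->
  \prod_(w <- l) w = \prod_(g <- iota 0 L) g ^ count_mem g l.
Proof.
elim: l => [|a l IH] lL; first by rewrite big_nil big1.
rewrite big_cons IH => [|w wl]; last by apply: lL; rewrite inE wl orbT.
under [RHS]eq_bigr => g _ do rewrite /= expnD.
rewrite big_split /=; congr (_ * _).
have aL : a \in iota 0 L by rewrite mem_iota lL ?mem_head.
rewrite (bigD1_seq a)//= ?iota_uniq// eqxx expn1 big1 ?muln1// => g /negPf ga.
by rewrite eq_sym ga.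
Qed.

Lemma productsP E (l : seq nat) :
  {in l, forall w, E w} -> products E (size l) (\prod_(w <- l) w).
Proof.
elim: l => [|a l IH] lE /=; first by rewrite big_nil.
exists a, (\prod_(w <- l) w); rewrite big_cons; split=> //.
  by apply: lE; apply: mem_head.
by apply: IH => w wl; apply: lE; rewrite inE wl orbT.
Qed.

Definition power_below (L w : nat) : Prop := exists g b, g < L /\ w = g ^ b.

(** Consecutive powers differ by a factor at least 2, so a dyadic interval
    contains at most one. *)
Lemma powers_thin g : log_thin (fun w => exists b, w = g ^ b).
Proof.
exists 1 => j; rewrite mul1n.
have [[b gb]|none] := pselect (exists b, 2 ^ j <= g ^ b < 2 ^ j.+1); last first.
  exists [::] => [w [b ->] wj|]; last by rewrite muln0.
  by case: none; exists b.
exists [:: g ^ b]; last by rewrite muln1 ltn_expl.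
move=> _ [c ->] gc; rewrite inE; apply/eqP.
have [g1|g1] := leqP g 1.
  case: g g1 gb gc => [|[|//]] _; last by rewrite !exp1n.
  by case: b => [|b]; case: c => [|c]; rewrite ?expn0 ?exp0n// leqn0 expn_eq0.
congr (g ^ _); apply/eqP; rewrite eqn_leq; apply/andP.
have lt x y : 2 ^ j <= g ^ x -> g ^ y < 2 ^ j.+1 -> y <= x.
  move=> gx gy; rewrite -ltnS -(ltn_exp2l _ _ g1) expnS.
  by apply: leq_trans gy _; rewrite expnS; apply: leq_mul.
by move/andP: gb => [b1 b2]; move/andP: gc => [c1 c2]; split; apply: lt.
Qed.

Lemma power_below_thin L : log_thin (power_below L).
Proof.
elim: L => [|L IH].
  by exists 0 => j; exists [::]; [move=> w [g [b []]]|rewrite muln0].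
apply: log_thin_sub (log_thinU IH (powers_thin L)) => w [g [b [gL ->]]].
have [gL'|Lg] := ltnP g L; first by left; exists g, b.
by right; exists b; congr (_ ^ _); apply/eqP; rewrite eqn_leq Lg -ltnS gL.
Qed.

(** For p odd, p^k - 1 is even; for p = 2, an odd number forces a = 0. *)
Lemma odd_local_unit_order w :
  local_unit_order w -> odd w -> exists2 k, 0 < k & w = 2 ^ k - 1.
Proof.
move=> [p [k [a [p_pr k0 ->]]]]; rewrite oddM oddB ?expn_gt0 ?prime_gt0//.
rewrite !oddX /= addbT => /andP[]; rewrite negb_or -lt0n k0 /= => podd.
have p2 : p = 2 by case: (even_prime p_pr) => // po; rewrite po in podd.
rewrite (negPf podd) orbF => /eqP ->; exists k => //.
by rewrite p2 expn0 muln1.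
Qed.

(** The even factors are fewer than B because their product divides t; they are
    padded by ones to be B in number.  The odd ones are divisors 2^k - 1 of t, so
    they are below 2^K, and equal ones are grouped into a power. *)
Lemma local_product_structure B K t : local_product t ->
  ~~ (2 ^ B %| t) -> (forall k, K <= k -> ~~ (2 ^ k - 1 %| t)) ->
  products (fun w => local_unit_order w \/ power_below (2 ^ K) w)
    (B + 2 ^ K) t.
Proof.
move=> [l lP ->] tB tK.
rewrite (bigID odd) /= -big_filter -[X in _ * X]big_filter.
set lo := [seq w <- l | odd w]; set le := [seq w <- l | ~~ odd w].
have leB : size le <= B.
  apply: contraNT tB; rewrite -ltnNge => /ltnW Ble.
  apply: dvdn_trans (dvdn_exp2l 2 Ble) _.
  rewrite (bigID odd) /= -[X in _ * X]big_filter -/le dvdn_mull//.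
  have : all (fun w => ~~ odd w) le by apply: filter_all.
  elim: (le) => [|a r IH]; first by rewrite dvd1n.
  by move=> /= /andP[ao /IH ro]; rewrite big_cons expnS dvdn_mul// dvdn2.
have loL : {in lo, forall w, w < 2 ^ K}.
  move=> w; rewrite mem_filter => /andP[wo wl].
  have [k k0 wk] := odd_local_unit_order (lP _ wl) wo.
  rewrite wk; have [Kk|kK] := leqP K k.
    have /negP[] := tK _ Kk; rewrite -wk.
    by rewrite (big_rem w)//= dvdn_mulr.
  by rewrite subn1 prednK ?expn_gt0// leq_exp2l// ltnW.
have one : local_unit_order 1 by exists 2, 1, 0.
pose full := le ++ nseq (B - size le) 1 ++ [seq g ^ count_mem g lo | g <- iota 0 (2 ^ K)].
have <- : size full = B + 2 ^ K.
  by rewrite !size_cat size_nseq size_map size_iota addnA subnKC.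
have -> : (\prod_(w <- lo) w) * (\prod_(w <- le) w) = \prod_(w <- full) w.
  rewrite !big_cat /= big_map -prod_seq_count// mulnC; congr (_ * _).
  by rewrite big_nseq iter_muln_1 exp1n mul1n.
apply: productsP => w; rewrite !mem_cat => /or3P[|/nseqP[-> _]|/mapP[g]].
- by rewrite mem_filter => /andP[_ /lP]; left.
- by left.
- by rewrite mem_iota /= => gL ->; right; exists g, (count_mem g lo).
Qed.

(** The integers excluded in [local_product_structure] are multiples of 2^B or
    of some 2^k - 1 with k >= K, and their densities are at most 2^-B and the
    tail of a geometric series.  With B = 4 m and K = 4 m + 2 both are at most
    1/(4 m). *)
Lemma local_product_density m : density_at_most m local_product.
Proof.
pose E w := local_unit_order w \/ power_below (2 ^ (4 * m).+2) w.
have ET : log_thin E.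
  by apply: log_thinU; [exact: local_unit_order_thin|exact: power_below_thin].
have [N NP] := sparse_density
  (product_thin_sparse (products_thin (4 * m + 2 ^ (4 * m).+2) ET)) (4 * m).
exists N => n /NP[s3 s3m s3P].
pose s1 := multiples (2 ^ (4 * m)) n.
pose s2 := flatten [seq multiples (2 ^ k - 1) n | k <- iota (4 * m).+2 n].
exists (s1 ++ s2 ++ s3); last first.
  move=> t tT tn; rewrite !mem_cat.
  have [/mem_multiples->//|t1] := boolP (2 ^ (4 * m) %| t).
  have [[k Kk kt]|none] := pselect (exists2 k, (4 * m).+2 <= k & 2 ^ k - 1 %| t).
    apply/orP; right; apply/orP; left; apply/flatten_mapP; exists k; last exact: mem_multiples.
    rewrite mem_iota Kk /=.
    have [t0 tn'] := andP tn; have := dvdn_leq t0 kt.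
    by have := ltn_expl k (isT : 1 < 2); lia.
  rewrite s3P ?orbT//; apply: local_product_structure => // k Kk.
  by apply/negP => kt; apply: none; exists k.
have le4 : 4 * m * (n %/ 2 ^ (4 * m)) <= n.
  apply: leq_trans (leq_trunc_div n (2 ^ (4 * m))); rewrite mulnC leq_mul2l.
  by rewrite ltnW ?orbT// ltn_expl.
have s1m : 4 * m * size s1 <= n by rewrite size_multiples.
have s2m : 4 * m * size s2 <= n.
  apply: leq_trans le4; rewrite leq_mul2l; apply/orP; right.
  rewrite size_flatten /shape -map_comp sumnE big_map.
  apply: leq_trans (sum_divn_exp2 (4 * m) n n).
  rewrite -[(4 * m).+2]add1n iotaDl big_map; apply: leq_sum => i _.
  rewrite /= size_multiples leq_div2l ?expn_gt0// add1n expnS.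
  have : 0 < 2 ^ i by rewrite expn_gt0.
  by lia.
by rewrite !size_cat; move: (size s1) (size s2) (size s3) s1m s2m s3m; lia.
Qed.

(** * Chains of invariant factors *)

(** The shape of the list of invariant factors of a finite abelian group, and
    of its tails. *)
Definition dvd_chain (s : seq nat) : bool :=
  sorted [rel m n | n %| m] s && all (ltn 1) s.

(** If (d_1, ..., d_r) is a chain, the weight of (d_2, ..., d_r) divides the
    product of the d_i, since d_2 divides d_1. *)
Definition chain_weight (s : seq nat) : nat := head 1 s * \prod_(d <- s) d.

Definition chain_quotient (s : seq nat) (k : nat) : nat :=
  nth 1 s k %/ nth 1 s k.+1.

Lemma dvd_chain_behead s : dvd_chain s -> dvd_chain (behead s).
Proof.
by case: s => [//|d s] /andP[/path_sorted so /andP[_ sa]]; apply/andP.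
Qed.

Lemma dvd_chain_nth_gt0 s k : dvd_chain s -> 0 < nth 1 s k.
Proof.
move=> /andP[_ /allP sa]; have [ks|sk] := ltnP k (size s); last by rewrite nth_default.
by apply: ltnW; apply: sa; apply: mem_nth.
Qed.

Lemma dvd_chain_dvd s k : dvd_chain s -> nth 1 s k.+1 %| nth 1 s k.
Proof.
move=> /andP[so _]; have [ks|sk] := ltnP k.+1 (size s); last by rewrite nth_default.
by move/(sortedP 1): so => /(_ k ks).
Qed.

Lemma chain_quotient_gt0 s k : dvd_chain s -> 0 < chain_quotient s k.
Proof.
move=> sc; rewrite divn_gt0 ?dvd_chain_nth_gt0//.
by apply: dvdn_leq; [apply: dvd_chain_nth_gt0|apply: dvd_chain_dvd].
Qed.

(** The product of the quotients telescopes; it ends at the default value 1. *)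
Lemma chain_quotientK s i K : dvd_chain s -> size s <= i + K ->
  \prod_(i <= k < i + K) chain_quotient s k = nth 1 s i.
Proof.
move=> sc; elim: K i => [|K IH] i sK.
  by rewrite addn0 big_geq// nth_default// -[i]addn0.
rewrite big_ltn ?addnS ?ltnS ?leq_addr// -addSn IH ?addSnnS//.
by rewrite divnK// dvd_chain_dvd.
Qed.

Lemma chain_quotient_inj K s t : dvd_chain s -> dvd_chain t ->
  size s <= K -> size t <= K ->
  (forall k, k < K -> chain_quotient s k = chain_quotient t k) -> s = t.
Proof.
move=> sc tc sK tK st.
have nthE i : nth 1 s i = nth 1 t i.
  have [iK|Ki] := leqP i K; last by rewrite !nth_default// ltnW// (leq_ltn_trans _ Ki).
  rewrite -(chain_quotientK (K := K - i) sc) ?subnKC//.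
  rewrite -(chain_quotientK (K := K - i) tc) ?subnKC//.
  by apply: eq_big_nat => k /andP[_ kK]; apply: st.
have le u v : dvd_chain u -> (forall i, nth 1 u i = nth 1 v i) -> size u <= size v.
  move=> /andP[_ /allP ua] uv; rewrite leqNgt; apply/negP => vu.
  by have := ua _ (mem_nth 1 vu); rewrite uv nth_default.
apply: (@eq_from_nth _ 1) => [|i _]; last exact: nthE.
by apply/eqP; rewrite eqn_leq !le.
Qed.

(** In the product of the entries of the chain, the quotient of index k occurs
    k + 1 times by [chain_quotientK], and once more in the first entry. *)
Lemma chain_weightE K s : dvd_chain s -> size s <= K ->
  chain_weight s = \prod_(k < K) chain_quotient s k ^ k.+2.
Proof.
elim: K s => [|K IH] s sc sK.
  by rewrite big_ord0; case: s sK {sc} => // _; rewrite /chain_weight big_nil.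
case: s sc sK => [|d s] sc sK.
  rewrite /chain_weight big_nil big1// => k _.
  by rewrite /chain_quotient !nth_nil divnn exp1n.
rewrite big_ord_recl.
under [X in _ = _ * X]eq_bigr => k _.
  rewrite (_ : _ ^ _ = chain_quotient s k ^ k.+2 * chain_quotient s k); last first.
    by rewrite -expnSr.
  over.
have sc' := dvd_chain_behead sc.
rewrite big_split /= -IH// -(big_mkord xpredT (chain_quotient s)).
rewrite (chain_quotientK (i := 0) (K := K))//.
have := divnK (dvd_chain_dvd 0 sc); rewrite -/(chain_quotient (d :: s) 0) /= => dE.
rewrite /chain_weight big_cons /= -{1 2}dE nth0 !expnS expn0.
move: (chain_quotient _ _) (head _ _) => x y.
by move: (\prod_(_ <- _) _) => z; ring.
Qed.

Section WeightSum.
Local Open Scope ring_scope.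

(** A truncation of zeta(k + 2); the terms from v = 2 on are compared with the
    telescoping bound for k = 0. *)
Lemma sum_inv_powers_le M k :
  \sum_(v < M) ((v.+1 ^ k.+2)%:R^-1 : rat) <= 1 + (2 ^ k)%:R^-1.
Proof.
case: M => [|M]; first by rewrite big_ord0 addr_ge0// invr_ge0 ler0n.
rewrite big_ord_recl exp1n invr1 lerD2l.
have sq : \sum_(v < M) ((v.+2 ^ 2)%:R^-1 : rat) <= 1 - M.+1%:R^-1.
  elim: M => [|M IH]; first by rewrite big_ord0 invr1 subrr.
  rewrite big_ord_recr /=; apply: le_trans (lerD IH (lexx _)) _.
  suff : ((M.+2 ^ 2)%:R^-1 : rat) <= M.+1%:R^-1 - M.+2%:R^-1.
    by move: (M.+1%:R^-1) (M.+2%:R^-1) ((M.+2 ^ 2)%:R^-1) => a b c; lra.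
  have -> : (M.+1%:R^-1 - M.+2%:R^-1 : rat) = (M.+1 * M.+2)%N%:R^-1.
    rewrite natrM -[M.+2]addn1 natrD.
    have : (0 : rat) < M.+1%:R by rewrite ltr0n.
    move: (M.+1%:R : rat) => x x0; field.
    by rewrite !gt_eqF ?addr_gt0.
  by rewrite lef_pV2 ?posrE ?ltr0n// ler_nat -mulnn leq_mul2r leqnSn orbT.
apply: (@le_trans _ _ ((2 ^ k)%:R^-1 * \sum_(v < M) (v.+2 ^ 2)%:R^-1)).
  rewrite mulr_sumr; apply: ler_sum => v _.
  have gt0 x y : (0 < x.+1 ^ y)%N by rewrite expn_gt0.
  rewrite -invfM -natrM lef_pV2 ?posrE ?ltr0n ?gt0//; last first.
    by rewrite muln_gt0 !gt0.
  rewrite ler_nat /= /bump /= add1n -[k.+2]addn2 expnD; apply: leq_mul => //.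
  by case: (k) => // k'; rewrite leq_exp2r.
rewrite ler_piMr ?invr_ge0 ?ler0n//; apply: le_trans sq _.
by rewrite gerBl invr_ge0 ler0n.
Qed.

(** The products increase, and the sharper bound 6 - 3/2^n for n + 2 factors is
    stable under adding a factor. *)
Lemma prod_1p_inv_exp2_le K : \prod_(k < K) (1 + (2 ^ k)%:R^-1 : rat) <= 6.
Proof.
have ge1 n : (0 : rat) <= (2 ^ n)%:R^-1 by rewrite invr_ge0 ler0n.
have bound n : \prod_(k < n.+2) (1 + (2 ^ k)%:R^-1 : rat) <= 6 - 3 * (2 ^ n)%:R^-1.
  elim: n => [|n IH].
    by rewrite !big_ord_recr big_ord0 /= mul1r expn0 expn1 invr1; lra.
  rewrite big_ord_recr /=; apply: le_trans (ler_wpM2r _ IH) _.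
    by rewrite addr_ge0.
  rewrite !expnS !natrM !invfM; have := ge1 n.
  by move: ((2 ^ n)%:R^-1 : rat) => x; nra.
apply: (@le_trans _ _ (\prod_(k < K.+2) (1 + (2 ^ k)%:R^-1 : rat))); last first.
  by apply: le_trans (bound K) _; have := ge1 K; lra.
have P0 n : 0 <= \prod_(k < n) (1 + (2 ^ k)%:R^-1 : rat).
  by apply: prodr_ge0 => k _; rewrite addr_ge0.
have step n : \prod_(k < n) (1 + (2 ^ k)%:R^-1 : rat) <= \prod_(k < n.+1) (1 + (2 ^ k)%:R^-1 : rat).
  by rewrite [X in _ <= X]big_ord_recr /= ler_peMr ?P0// lerDl.
exact: le_trans (step _) (step _).
Qed.

(** A chain is determined by its quotients, in terms of which the weight is a
    product ([chain_weightE]); so the sum is at most a finite product of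
    truncated zeta values. *)
Lemma chain_weight_sum_le (L : seq (seq nat)) : uniq L -> all dvd_chain L ->
  \sum_(s <- L) ((chain_weight s)%:R^-1 : rat) <= 6.
Proof.
move=> uL /allP LC.
pose K := (\max_(s <- L) size s)%N; pose M := (\max_(s <- L) \max_(d <- s) d)%N.
have LK s : s \in L -> (size s <= K)%N by move=> sL; apply: leq_bigmax_seq.
have LM s k : s \in L -> (chain_quotient s k <= M.+1)%N.
  move=> sL; apply: leq_trans (leq_div _ _) _.
  have [ks|sk] := ltnP k (size s); last by rewrite nth_default.
  apply: leqW; apply: leq_trans (_ : \max_(d <- s) d <= _)%N; last exact: leq_bigmax_seq.
  by apply: leq_bigmax_seq => //; apply: mem_nth.
(* Shifting the quotients, which are positive, makes a quotient 1 the value 0. *)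
pose e s := [ffun k : 'I_K => inord (chain_quotient s k).-1 : 'I_M.+1].
have eE s (k : 'I_K) : s \in L -> (e s k).+1 = chain_quotient s k.
  move=> sL; have q0 := chain_quotient_gt0 k (LC _ sL).
  by rewrite ffunE inordK prednK// LM.
pose G (f : {ffun 'I_K -> 'I_M.+1}) : rat := \prod_k (((f k).+1 ^ k.+2)%N%:R^-1).
have -> : \sum_(s <- L) ((chain_weight s)%:R^-1 : rat) = \sum_(f <- map e L) G f.
  rewrite big_map; apply: eq_big_seq => s sL.
  rewrite (chain_weightE (LC _ sL) (LK _ sL)) natr_prod -prodfV.
  by apply: eq_bigr => k _; rewrite eE.
have ue : uniq (map e L).
  rewrite map_inj_in_uniq// => s t sL tL /ffunP st.
  apply: (chain_quotient_inj (LC _ sL) (LC _ tL) (LK _ sL) (LK _ tL)) => k kK.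
  by rewrite -(eE _ (Ordinal kK))// st eE.
have G0 f : 0 <= G f by apply: prodr_ge0 => k _; rewrite invr_ge0 ler0n.
apply: (@le_trans _ _ (\sum_f G f)).
  rewrite big_uniq//= big_mkcond /=; apply: ler_sum => f _.
  by case: ifP.
rewrite -(bigA_distr_bigA (fun (k : 'I_K) (v : 'I_M.+1) => (v.+1 ^ k.+2)%N%:R^-1 : rat)).
apply: le_trans (prod_1p_inv_exp2_le K); apply: ler_prod => k _.
by rewrite sum_inv_powers_le sumr_ge0// => v _; rewrite invr_ge0 ler0n.
Qed.

(** Choose L0 so that q times its sum reaches the largest integer that any
    finite list allows; a disjoint list with sum above 1/q would reach the next. *)
Lemma chain_weight_tail q : exists L0 : seq (seq nat),
  forall L, uniq L -> all dvd_chain L -> {in L, forall s, s \notin L0} ->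
    q%:R * \sum_(s <- L) ((chain_weight s)%:R^-1 : rat) <= 1.
Proof.
pose P N := `[< exists L, [/\ uniq L, all dvd_chain L &
  N%:R <= q%:R * \sum_(s <- L) ((chain_weight s)%:R^-1 : rat)] >].
have P0 : exists N, P N by exists 0%N; apply/asboolP; exists [::]; rewrite big_nil mulr0.
have PM N : P N -> (N <= q * 6)%N.
  move=> /asboolP[L [uL LC /le_trans]] NL; rewrite -(ler_nat rat); apply: NL.
  by rewrite natrM ler_wpM2l// chain_weight_sum_le.
have [N /asboolP[L0 [u0 C0 N0]] Nmax] := ex_maxnP P0 PM.
exists L0 => L uL LC disj; rewrite leNgt; apply/negP => gt1.
suff /Nmax : P N.+1 by rewrite ltnn.
apply/asboolP; exists (L0 ++ L); split; rewrite ?all_cat ?C0 ?LC//.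
  rewrite cat_uniq u0 uL andbT; apply/hasPn => s sL; exact: disj.
by rewrite big_cat mulrDr -natr1 lerD// ltW.
Qed.

End WeightSum.

Lemma sum_divn_chain_weight q (L : seq (seq nat)) n :
  (q%:R * \sum_(s <- L) ((chain_weight s)%:R^-1 : rat) <= 1)%R ->
  q * \sum_(s <- L) n %/ chain_weight s <= n.
Proof.
move=> le1; rewrite -(ler_nat rat) natrM natr_sum.
have : (n%:R * (q%:R * \sum_(s <- L) (chain_weight s)%:R^-1) <= n%:R * 1 :> rat)%R.
  by rewrite ler_wpM2l.
rewrite mulr1 => /(le_trans _); apply; rewrite mulrCA ler_wpM2l// mulr_sumr.
apply: ler_sum => s _; have [w0|w0] := posnP (chain_weight s).
  by rewrite w0 divn0 invr0 mulr0.
by rewrite ler_pdivlMr ?ltr0n// -natrM ler_nat leq_trunc_div.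
Qed.

(** * Counting abelian groups *)

(** The order and the tail of the list of invariant factors give back the first
    invariant factor, hence the group. *)
Definition abelian_code (gT : finGroupType) : nat * seq nat :=
  (#|gT|, behead (abelian_type [set: gT])).

Lemma abelian_type_chain (gT : finGroupType) (A : {set gT}) :
  dvd_chain (abelian_type A).
Proof.
by apply/andP; split; [exact: abelian_type_dvdn_sorted|exact: abelian_type_gt1].
Qed.

(** The group is a direct product of cyclic groups of orders d_i. *)
Lemma prod_abelian_type (gT : finGroupType) (G : {group gT}) :
  abelian G -> \prod_(d <- abelian_type G) d = #|G|.
Proof.
move=> /abelian_structure[b defG <-]; rewrite big_map -(bigdprod_card defG).
by apply: eq_bigr.
Qed.

Lemma abelian_code_isog (gT hT : finGroupType) :
  finite_abelian gT -> finite_abelian hT ->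
  abelian_code gT = abelian_code hT -> [set: gT] \isog [set: hT].
Proof.
move=> gA hA [card tail]; rewrite eq_abelian_type_isog//; apply/eqP.
have := prod_abelian_type gA; have := prod_abelian_type hA.
rewrite !cardsT card => <-.
have := abelian_type_chain [set: gT]; have := abelian_type_chain [set: hT].
move: (abelian_type [set: gT]) (abelian_type [set: hT]) tail.
case=> [|d s] [|c t] //= st; rewrite ?big_cons ?big_nil.
(* The trivial group and the cyclic groups have the same empty tail; the order
   tells them apart because entries exceed 1. *)
- by rewrite -st big_nil muln1 => /andP[_ /andP[c1 _]] _ c1'; rewrite -c1' in c1.
- by rewrite st big_nil muln1 => _ /andP[_ /andP[d1 _]] d1'; rewrite d1' in d1.
rewrite st => /andP[_ /andP[_ tA]] _ /eqP; rewrite eqn_pmul2r.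
  by move=> /eqP ->.
rewrite big_seq; apply: prodn_cond_gt0 => i /(allP tA); exact: ltnW.
Qed.

Lemma chain_weight_code_dvd (gT : finGroupType) : finite_abelian gT ->
  chain_weight (abelian_code gT).2 %| (abelian_code gT).1.
Proof.
move=> gA; rewrite /= -cardsT -(prod_abelian_type gA).
have := dvd_chain_dvd 0 (abelian_type_chain [set: gT]).
case: (abelian_type _) => [|d s] /=; first by rewrite /chain_weight big_nil.
by rewrite nth0 big_cons => ds; apply: dvdn_mul.
Qed.

(** Codes with a chain in L0 number at most |s| |L0|.  For any other chain, the
    order is a multiple of its weight, so that [chain_weight_tail] bounds the
    number of remaining codes by n / (2 m). *)
Lemma size_codes_le m : exists L0 : seq (seq nat),
  forall n (c : seq (nat * seq nat)) (s : seq nat), uniq c ->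
    {in c, forall x, [&& dvd_chain x.2, chain_weight x.2 %| x.1, 0 < x.1 & x.1 <= n]} ->
    {in c, forall x, x.1 \in s} ->
    2 * m * size c <= 2 * m * (size s * size L0) + n.
Proof.
have [L0 L0P] := chain_weight_tail (2 * m); exists L0 => n c s uc cP cs.
pose c0 := [seq x <- c | x.2 \in L0]; pose c1 := [seq x <- c | x.2 \notin L0].
have -> : size c = size c0 + size c1.
  by rewrite !size_filter -(count_predC (fun x => x.2 \in L0)).
rewrite mulnDr; apply: leq_add.
  rewrite leq_mul2l; apply/orP; right; rewrite -(size_allpairs pair).
  apply: uniq_leq_size => [|[t a]]; first exact: filter_uniq.
  by rewrite mem_filter /= => /andP[aL xc]; apply: (allpairs_f pair) => //; apply: cs xc.
pose L := undup [seq x.2 | x <- c1].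
have LP a : a \in L -> exists2 x, x \in c1 & a = x.2.
  by rewrite mem_undup => /mapP.
apply: leq_trans (sum_divn_chain_weight n (L0P L (undup_uniq _) _ _)); first last.
- by move=> a /LP[x]; rewrite mem_filter => /andP[] ? _ ->.
- by apply/allP => a /LP[x]; rewrite mem_filter => /andP[_ /cP/and4P[? _ _ _]] ->.
rewrite leq_mul2l; apply/orP; right.
apply: (@leq_trans (size [seq (t, a) | a <- L, t <- multiples (chain_weight a) n])).
  apply: uniq_leq_size => [|[t a] xc1]; first exact: filter_uniq.
  have := xc1; rewrite mem_filter => /andP[_ /cP/and4P[_ /= wt t0 tn]].
  apply/allpairsPdep; exists a, t; split=> //; last by apply: mem_multiples; rewrite // t0.
  by rewrite mem_undup; apply/mapP; exists (t, a).
rewrite size_allpairs_dep sumnE big_map; apply: leq_sum => a _.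
by rewrite size_multiples.
Qed.

Section Counts.
Local Open Scope ring_scope.

Lemma class_count_units_le (R : realType) m : exists N, forall x : R,
  N%:R <= x ->
  (m * class_count abelian_units_positive_characteristic x <= Num.truncn x)%N.
Proof.
have [L0 L0P] := size_codes_le m.
have [N NP] := local_product_density (2 * m * size L0).
exists N => x Nx; have x0 : 0 <= x by apply: le_trans Nx; apply: ler0n.
have leE n : (n%:R <= x) = (n <= Num.truncn x)%N by rewrite truncn_ge_nat.
have /NP[s sle sP] : (N <= Num.truncn x)%N by rewrite -leE.
have [F [F1 F2 _]] := (class_countP abelian_units_positive_characteristic x _).1 erefl.
move: (class_count _ x) F F1 F2 => k F F1 F2.
pose c := [seq abelian_code (F i) | i <- enum 'I_k].
have ab i : finite_abelian (F i) by have [[]] := F1 i.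
have uc : uniq c.
  rewrite map_inj_uniq ?enum_uniq// => i j ij; apply: F2.
  by apply: abelian_code_isog ij.
have /= := L0P (Num.truncn x) c s uc.
rewrite size_map size_enum_ord => le.
suff : (2 * m * k <= 2 * m * (size s * size L0) + Num.truncn x)%N.
  by move: sle; rewrite mulnCA mulnC; move: (size s * size L0)%N => y; lia.
have card0 i : (0 < #|F i| <= Num.truncn x)%N.
  by rewrite -leE (proj2 (F1 i)) andbT; apply/card_gt0P; exists 1%g.
apply: le => _ /mapP[i _ ->]; last first.
  by apply: sP; [exact: (card_abelian_units (proj1 (F1 i)))|exact: card0].
by rewrite chain_weight_code_dvd// dvd_chain_behead ?abelian_type_chain//= card0.
Qed.

(** The cyclic groups of orders 1, ..., floor(x). *)
Lemma class_count_abelian_ge (R : realType) (x : R) : 0 <= x ->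
  (Num.truncn x <= class_count finite_abelian x)%N.
Proof.
move=> x0; have [F [_ _ F3]] := (class_countP finite_abelian x _).1 erefl.
move: (class_count _ x) F F3 => k F F3.
have /choice[h hP] (i : 'I_(Num.truncn x)) : exists j, [set: 'I_i.+1] \isog [set: F j].
  apply: F3; first exact: FinRing.zmod_abelian.
  by rewrite card_ord -truncn_ge_nat.
have /leq_card : injective h; last by rewrite !card_ord.
move=> i j ij; apply: val_inj; apply/eqP; rewrite -eqSS.
have := card_isog (hP i); have := card_isog (hP j).
by rewrite !cardsT !card_ord ij => -> ->.
Qed.

End Counts.

(** * The density *)

Local Open Scope classical_set_scope.
Local Open Scope ring_scope.

Theorem theorem6p2 (R : realType) :
  (class_count abelian_units_positive_characteristic x)%:R
    / (class_count finite_abelian x)%:R @[x --> (+oo : set_system R)]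
  --> (0 : R).
Proof.
apply/cvgrPdist_le => e e0.
pose m := (Num.truncn e^-1).+1; have [N NP] := class_count_units_le R m.
near=> x.
have Nx : N%:R <= x by near: x; apply: nbhs_pinfty_ge; rewrite num_real.
have x0 : 0 <= x by apply: le_trans Nx; apply: ler0n.
rewrite sub0r normrN ger0_norm; last by rewrite divr_ge0 ?ler0n.
have le := leq_trans (NP x Nx) (class_count_abelian_ge x0).
have [A0|A0] := posnP (class_count finite_abelian x).
  by rewrite A0 invr0 mulr0 ltW.
rewrite ler_pdivrMr ?ltr0n//.
have em : 1 <= e * m%:R.
  by rewrite mulrC -ler_pdivrMr// div1r ltW// truncnS_gt.
move: le; rewrite -(ler_nat R) natrM => le.
apply: le_trans (ler_wpM2l (ltW e0) le).
by rewrite mulrA ler_peMl// ler0n.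
Unshelve. all: by end_near.
Qed.
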